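(* Let $G$ be a graph with edge set $E(G)=\{e_1,\ldots,e_m\}$ and let $Q=(q(i,j))$ be the $m\times m$ cost matrix of the QMST on $G$. If $\pi$ is a permutation of $\{1,\ldots,m\}$ such that $\pi(Q)$ is doubly graded, then the $\pi$-critical spanning tree of $G$ is an optimal solution of the QMST with cost matrix $Q$.
   Context: QMST: given costs $c_{e_i}$ and $q(i,j)=q(e_i,e_j)$ for $i\neq j$, minimize $z(T)=\sum_{e\in T}\sum_{f\in T,f\neq e}q(e,f)+\sum_{e\in T}c_e$ over all spanning trees $T$ of $G$; its cost matrix $Q$ has $(i,j)$-entry $q(i,j)$ for $i\neq j$ and $c_{e_i}$ for $i=j$. An $m\times m$ matrix $Q$ is row graded if $q(i,1)\leq\cdots\leq q(i,m)$ for all $i$, and doubly graded if both $Q$ and its transpose $Q^T$ are row graded. For a permutation $\pi$ of $\{1,\ldots,m\}$, $\pi(Q)$ is the matrix with $(i,j)$-entry $q(\pi^{-1}(i),\pi^{-1}(j))$. The $\pi$-critical spanning tree is the spanning tree $T=\{e_{i_1},\ldots,e_{i_{n-1}}\}$ for which $\{\pi(i_1),\ldots,\pi(i_{n-1})\}$ is lexicographically smallest (comparing sets as increasingly sorted sequences) among all spanning trees of $G$. *)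

(* Defs.v *)
From mathcomp Require Import all_boot all_order fingroup perm all_algebra.

Set Implicit Arguments.
Unset Strict Implicit.
Unset Printing Implicit Defensive.

Import Order.TTheory GRing.Theory Num.Theory.

Local Open Scope ring_scope.

Record sgraph (V : finType) := SGraph {
  adj : rel V;
  adj_sym : symmetric adj;
  adj_irr : irreflexive adj
}.

(* An edge is the unordered pair of its endpoints. *)
Definition edges (V : finType) (G : sgraph V) : {set {set V}} :=
  [set [set p.1; p.2] | p : V * V & adj G p.1 p.2].

Definition edge_enumeration (V : finType) (G : sgraph V) (m : nat)
    (e : 'I_m -> {set V}) : Prop :=
  injective e /\ [set e i | i : 'I_m] = edges G.

Definition edge_rel (V : finType) (T : {set {set V}}) : rel V :=
  [rel x y | [set x; y] \in T].

Definition connected_edges (V : finType) (T : {set {set V}}) : Prop :=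
  forall x y : V, connect (edge_rel T) x y.

(* The bound on the length excludes walking back and forth along one edge. *)
Definition acyclic_edges (V : finType) (T : {set {set V}}) : Prop :=
  forall c : seq V, (2 < size c)%N -> ~ ucycle (edge_rel T) c.

(* A spanning tree is identified with its edge set. *)
Definition spanning_tree (V : finType) (G : sgraph V) (T : {set {set V}}) : Prop :=
  [/\ T \subset edges G, connected_edges T & acyclic_edges T].

Definition qmst_cost (R : realFieldType) (V : finType)
    (c : {set V} -> R) (q : {set V} -> {set V} -> R) (T : {set {set V}}) : R :=
  \sum_(e in T) \sum_(f in T | f != e) q e f + \sum_(e in T) c e.

Definition qmst_optimal (R : realFieldType) (V : finType) (G : sgraph V)
    (c : {set V} -> R) (q : {set V} -> {set V} -> R) (T : {set {set V}}) : Prop :=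
  spanning_tree G T /\
  forall T' : {set {set V}}, spanning_tree G T' ->
    qmst_cost c q T <= qmst_cost c q T'.

Definition cost_matrix (R : realFieldType) (V : finType) (m : nat)
    (e : 'I_m -> {set V})
    (c : {set V} -> R) (q : {set V} -> {set V} -> R) : 'M[R]_m :=
  \matrix_(i, j) if i == j then c (e i) else q (e i) (e j).

Definition row_graded (R : realFieldType) (m : nat) (A : 'M[R]_m) : Prop :=
  forall i j k : 'I_m, (j <= k)%N -> A i j <= A i k.

Definition doubly_graded (R : realFieldType) (m : nat) (A : 'M[R]_m) : Prop :=
  row_graded A /\ row_graded A^T.

Definition permute_matrix (R : realFieldType) (m : nat) (p : 'S_m)
    (A : 'M[R]_m) : 'M[R]_m :=
  \matrix_(i, j) A ((p^-1)%g i) ((p^-1)%g j).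

Definition sorted_indices (m : nat) (I : {set 'I_m}) : seqlexi nat :=
  sort leq [seq val i | i <- enum I].

Definition permuted_indices (V : finType) (m : nat) (e : 'I_m -> {set V})
    (p : 'S_m) (T : {set {set V}}) : {set 'I_m} :=
  [set p i | i : 'I_m & e i \in T].

Definition critical_spanning_tree (V : finType) (G : sgraph V) (m : nat)
    (e : 'I_m -> {set V}) (p : 'S_m) (T : {set {set V}}) : Prop :=
  spanning_tree G T /\
  forall T' : {set {set V}}, spanning_tree G T' ->
    (sorted_indices (permuted_indices e p T)
       <= sorted_indices (permuted_indices e p T'))%O.

(* Main.v *)
Require Import Defs.
From mathcomp Require Import all_boot all_order fingroup perm all_algebra.

(** The cost of a spanning tree is the sum of the entries of [Q] over all pairs
    of its edges, so replacing an edge of a tree by one of smaller rank does not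
    increase the cost when [pi(Q)] is doubly graded.  Compare the critical tree
    [T] with a spanning tree [T'] at the least rank [i] where they differ.  If
    the edge of rank [i] were in [T'], exchanging would yield an edge of [T] of
    rank larger than [i], so [T'] would be lexicographically smaller than [T].
    Hence it lies in [T], and it can be exchanged into [T'] for an edge of
    larger rank outside [T]; this does not increase the cost and brings [T']
    closer to [T]. *)

Set Implicit Arguments.
Unset Strict Implicit.
Unset Printing Implicit Defensive.

Import Order.TTheory GRing.Theory Num.Theory.

(** * Connectivity by edge sets, bridges and acyclicity *)

Section Connectivity.

Variable V : finType.
Implicit Types (S T : {set {set V}}) (f g : {set V}) (x y u v : V).

Lemma edge_rel_sym T : symmetric (edge_rel T).
Proof. by move=> x y; rewrite /edge_rel /= setUC. Qed.

Lemma connect_edge_sym T x y :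
  connect (edge_rel T) x y = connect (edge_rel T) y x.
Proof. exact/sym_connect_sym/edge_rel_sym. Qed.

Lemma connect_edgeS S T x y : S \subset T ->
  connect (edge_rel S) x y -> connect (edge_rel T) x y.
Proof.
move=> sST; apply: connect_sub => u v uv; apply: connect1.
exact: (subsetP sST).
Qed.

Lemma eq_set2 x y u v :
  [set u; v] = [set x; y] -> (u = x /\ v = y) \/ (u = y /\ v = x).
Proof.
move=> E.
have: u \in [set x; y] by rewrite -E !inE eqxx.
have: v \in [set x; y] by rewrite -E !inE eqxx orbT.
have: x \in [set u; v] by rewrite E !inE eqxx.
have: y \in [set u; v] by rewrite E !inE eqxx orbT.
rewrite !inE => /orP[]/eqP-> /orP[]/eqP-> /orP[]/eqP Ev /orP[]/eqP Eu;
  by [left | right].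
Qed.

(** One crossing of the new edge suffices: a second crossing cancels the first, and the induction
    along the path performs this cancellation. *)
Lemma connect_add_edge S x y u v :
  connect (edge_rel ([set x; y] |: S)) u v ->
  [\/ connect (edge_rel S) u v,
      connect (edge_rel S) u x /\ connect (edge_rel S) y v
    | connect (edge_rel S) u y /\ connect (edge_rel S) x v].
Proof.
case/connectP=> s; elim: s u => [|w s IH] u /=.
  by move=> _ ->; constructor 1.
case/andP=> uw /IH{}IH /IH{IH}.
move: uw; rewrite /edge_rel /= !inE => /orP[/eqP/eq_set2 [[-> ->]|[-> ->]]|uw].
- case=> [yv|[_ yv]|[_ xv]]; first by constructor 2.
  + by constructor 2.
  + by constructor 1.
- case=> [xv|[_ yv]|[_ xv]]; first by constructor 3.
  + by constructor 1.
  + by constructor 3.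
- have cuw : connect (edge_rel S) u w by apply: connect1.
  case=> [wv|[wx yv]|[wy xv]].
  + by constructor 1; apply: connect_trans wv.
  + by constructor 2; split=> //; apply: connect_trans wx.
  + by constructor 3; split=> //; apply: connect_trans wy.
Qed.

(** A simple path between the ends that avoids the edge would close up with it to a cycle; this has
    more than two vertices, since a one-step path would be the removed edge itself. *)
Lemma acyclic_edge_bridge T x y : acyclic_edges T -> x != y ->
  [set x; y] \in T -> ~~ connect (edge_rel (T :\ [set x; y])) x y.
Proof.
move=> acT neq_xy Txy; apply/negP=> /connectP[s0 /shortenP[s ps us _] Ey].
apply: (acT (x :: s)).
  case: s ps us Ey => [|z [|w s]] //=.
    by move=> _ _ E; rewrite E eqxx in neq_xy.
  by rewrite /edge_rel /= !inE andbT => + _ E; rewrite -E eqxx.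
rewrite /ucycle us andbT /= rcons_path -Ey; apply/andP; split.
  by apply: sub_path ps => u v; rewrite /edge_rel /= !inE => /andP[].
by rewrite edge_rel_sym.
Qed.

(** The rest of a cycle joins the ends of its first edge without using that edge. Acyclicity after
    an exchange can thus be checked edge by edge. *)
Lemma bridges_acyclic T :
  (forall x y, x != y -> [set x; y] \in T ->
     ~~ connect (edge_rel (T :\ [set x; y])) x y) ->
  acyclic_edges T.
Proof.
move=> brT [|x [|y [|z s]]] //= _ /andP[/= /and3P[Txy Tyz ps]].
rewrite !inE !negb_or => /andP[/and3P[neq_xy neq_xz xs]].
case/andP=> /andP[neq_yz ys] _.
have [] := negP (brT x y neq_xy Txy).
rewrite connect_edge_sym.
(* Every edge of the cycle after [y] is reached has an end other than [x] and [y], namely [z] or a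
   later vertex. *)
have avoid u v : u != x -> u != y -> [set u; v] != [set x; y].
  by move=> ux uy; apply/eqP=> /eq_set2[[E _]|[E _]]; rewrite E eqxx in ux uy.
apply: (@connect_trans _ _ z).
  apply: connect1; rewrite /edge_rel /= !inE; apply/andP; split=> //.
  by rewrite setUC avoid // eq_sym.
apply/connectP; exists (rcons s x); last by rewrite last_rcons.
rewrite eq_sym in neq_xz; rewrite eq_sym in neq_yz.
elim: s z ps neq_xz neq_yz xs ys {Tyz} => [|w s IH] z /=.
  by rewrite !andbT => Tzx zx zy _ _; rewrite /edge_rel /= !inE avoid.
move=> /andP[Tzw ps] zx zy; rewrite !inE !negb_or !(eq_sym _ w).
case/andP=> wx xs /andP[wy ys]; rewrite IH // andbT.
by rewrite /edge_rel /= !inE avoid.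
Qed.

End Connectivity.

(** * Exchange of edges between spanning trees *)

Section SpanningTrees.

Variables (V : finType) (G : sgraph V).
Implicit Types (S T : {set {set V}}) (f g : {set V}).

Lemma edgesP g : g \in edges G -> exists x y, x != y /\ g = [set x; y].
Proof.
case/imsetP=> -[x y]; rewrite inE /= => xy ->; exists x, y; split=> //.
by apply: contraTneq xy => ->; rewrite adj_irr.
Qed.

(* [f] is taken in a minimal subset of [T] joining the ends of [g]; no simple
   path has to be chosen. *)
Lemma spanning_tree_exchange T T' g :
  spanning_tree G T -> spanning_tree G T' -> g \in T' -> g \notin T ->
  exists f, [/\ f \in T, f \notin T' & spanning_tree G (g |: T :\ f)].
Proof.
move=> [sT conT acT] [sT' _ acT'] gT' gT.
have [x [y [neq_xy Eg]]] := edgesP (subsetP sT' _ gT').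
have [M] := @minset_exists _ (fun S => connect (edge_rel S) x y) T (conT x y).
case/minsetP=> Mxy minM sMT.
(* Otherwise [M], which avoids [g], would join the ends of [g] inside [T'] without [g]. *)
have /subsetPn[f fM fT'] : ~~ (M \subset T').
  apply/negP=> sMT'; have := acyclic_edge_bridge acT' neq_xy.
  rewrite -Eg => /(_ gT')/negP; apply; apply: connect_edgeS Mxy.
  apply/subsetP=> h hM; rewrite !inE (subsetP sMT') // andbT.
  by apply: contraNneq gT => <-; apply: (subsetP sMT).
have fT := subsetP sMT _ fM.
have [u [v [neq_uv Ef]]] := edgesP (subsetP sT _ fT).
pose S := T :\ f.
have sMS : M :\ f \subset S by apply: setSD.
have NSuv : ~~ connect (edge_rel S) u v.
  by rewrite /S Ef; apply: acyclic_edge_bridge => //; rewrite -Ef.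
have {}Mxy : connect (edge_rel ([set u; v] |: (M :\ f))) x y.
  by rewrite -Ef setD1K.
(* By minimality of [M], getting from [x] to [y] requires crossing [f]; [u'] and [v'] are its ends
   in the order of crossing. *)
have {fM Mxy} [u' [v' [Ef' xu vy]]] : exists u' v',
    [/\ f = [set u'; v'], connect (edge_rel S) x u'
      & connect (edge_rel S) v' y].
  case: (connect_add_edge Mxy) => [Mfxy|[xu vy]|[xv uy]].
  - have := minM _ Mfxy (subsetDl _ _) => E.
    by move: fM; rewrite -E !inE eqxx.
  - by exists u, v; split=> //; apply: connect_edgeS sMS _.
  - by exists v, u; split; [rewrite setUC | apply: connect_edgeS sMS _
      | apply: connect_edgeS sMS _].
have {u v neq_uv Ef}NSuv : ~~ connect (edge_rel S) u' v'.
  apply: contra NSuv => cuv.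
  move/esym: Ef'; rewrite Ef => /eq_set2[] [<- <-] //.
  by rewrite connect_edge_sym.
have NSxy : ~~ connect (edge_rel S) x y.
  apply: contra NSuv => xy; apply: connect_trans (connect_trans _ xy) _.
    by rewrite connect_edge_sym.
  by rewrite connect_edge_sym.
have sS : S \subset g |: S by apply: subsetUr.
exists f; split=> //; split.
- apply/subsetP=> h; rewrite !inE => /orP[/eqP->|/andP[_ hT]].
    exact: (subsetP sT').
  exact: (subsetP sT).
(* Edges of [T] other than [f] survive, and [f] is bypassed by going through [g]. *)
- move=> a b; apply: connect_sub (conT a b) => {}a {}b ab.
  have cuv : connect (edge_rel (g |: S)) u' v'.
    apply: (@connect_trans _ _ x).
      by rewrite connect_edge_sym; apply: connect_edgeS xu.
    apply: (@connect_trans _ _ y).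
      by apply: connect1; rewrite /edge_rel /= Eg setU11.
    by rewrite connect_edge_sym; apply: connect_edgeS vy.
  have [E|neq] := eqVneq [set a; b] f.
    rewrite -/S; move: (etrans E Ef') => /eq_set2[] [-> ->] //.
    by rewrite connect_edge_sym.
  apply: connect1; move: ab; rewrite /edge_rel /= !inE neq => ->.
  by rewrite orbT.
(* The edge [g] is a bridge because [S] separates [x] from [y]. A detour around another edge either
   avoids [g], and so exists in [T], or crosses [g], and then together with that edge it joins [x]
   to [y] in [S]. *)
- apply: bridges_acyclic => a b neq_ab; rewrite -/S in_setU1.
  have [E _|neq /= abS] := eqVneq [set a; b] g.
    have sD : (g |: S) :\ g \subset S.
      by apply/subsetP=> h; rewrite !inE => /andP[/negPf->].
    apply: contra NSxy; rewrite E => /(connect_edgeS sD) cab.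
    move: (etrans E Eg) => /eq_set2[] [<- <-] //.
    by rewrite connect_edge_sym.
  have abT : [set a; b] \in T by move: abS; rewrite inE => /andP[].
  have cab : connect (edge_rel S) a b by apply: connect1.
  have sSab : S :\ [set a; b] \subset S by apply: subsetDl.
  have -> : (g |: S) :\ [set a; b] = [set x; y] |: (S :\ [set a; b]).
    apply/setP=> h; rewrite -Eg !inE; case: eqVneq => // ->.
    by rewrite (negPf neq).
  apply/negP=> /connect_add_edge[cab'|[ax yb]|[ay xb]].
  + have := negP (acyclic_edge_bridge acT neq_ab abT); apply.
    by apply: connect_edgeS cab'; apply: setSD; apply: subsetDl.
  + case/negP: NSxy; apply: connect_trans (connect_trans _ cab) _.
      by rewrite connect_edge_sym; apply: connect_edgeS ax.
    by rewrite connect_edge_sym; apply: connect_edgeS yb.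
  + case/negP: NSxy; rewrite connect_edge_sym.
    apply: connect_trans (connect_trans _ cab) _.
      by rewrite connect_edge_sym; apply: connect_edgeS ay.
    by rewrite connect_edge_sym; apply: connect_edgeS xb.
Qed.

End SpanningTrees.

(** * Lexicographic comparison of sorted index sets *)

(* The element [k] is needed: a proper prefix [s] of [t] is smaller than [t]. *)
Lemma sorted_seqlexi_gt (s t : seqlexi nat) (i k : nat) :
  sorted ltn s -> sorted ltn t ->
  (forall j, j < i -> (j \in (s : seq nat)) = (j \in (t : seq nat))) ->
  i \in (t : seq nat) -> i \notin (s : seq nat) ->
  k \in (s : seq nat) -> i < k -> ~~ (s <= t)%O.
Proof.
elim: s t => [|a s IH] [|b t] //= ss st eq_st it is_ ks ik.
have s_gt j : j \in (s : seq nat) -> a < j.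
  by move=> js; apply: (allP (order_path_min ltn_trans ss)).
have t_gt j : j \in (t : seq nat) -> b < j.
  by move=> jt; apply: (allP (order_path_min ltn_trans st)).
rewrite Order.SeqLexiOrder.lexi_cons.
move: it is_; rewrite !inE negb_or => it /andP[neq_ia i_s].
have bi : b <= i by case/orP: it => [/eqP->|/t_gt/ltnW].
case: (ltngtP a b) => [ab|ba|Eab].
(* Here [a] lies below [i], so by agreement it would occur in [t], below the least entry [b]. *)
- have := eq_st a (leq_trans ab bi); rewrite !inE eqxx (ltn_eqF ab) /=.
  by move/esym/t_gt; rewrite ltnNge (ltnW ab).
- by rewrite leEnat leqNgt ba.
- subst b; rewrite lexx /=; apply: IH => //.
  + exact: path_sorted ss.
  + exact: path_sorted st.
  + move=> j ji; have := eq_st j ji; rewrite !inE; case: eqVneq => //= -> _.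
    by apply/idP/idP=> [/s_gt|/t_gt]; rewrite ltnn.
  + by move: it; rewrite (negPf neq_ia).
  + have ai : a < i by rewrite ltn_neqAle eq_sym neq_ia bi.
    by move: ks; rewrite inE (gtn_eqF (ltn_trans ai ik)).
Qed.

Lemma mem_sorted_indices m (I : {set 'I_m}) (i : 'I_m) :
  (val i \in (sorted_indices I : seq nat)) = (i \in I).
Proof. by rewrite mem_sort (mem_map val_inj) mem_enum. Qed.

Lemma sorted_indices_ltn m (I : {set 'I_m}) : sorted ltn (sorted_indices I).
Proof.
rewrite ltn_sorted_uniq_leq sort_uniq (map_inj_uniq val_inj) enum_uniq.
exact: (sort_sorted leq_total).
Qed.

Lemma sorted_indices_gt m (I J : {set 'I_m}) (i k : 'I_m) :
  (forall j : 'I_m, j < i -> (j \in I) = (j \in J)) ->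
  i \in J -> i \notin I -> k \in I -> i < k ->
  ~~ (sorted_indices I <= sorted_indices J)%O.
Proof.
move=> eqIJ iJ iI kI ik.
apply: (@sorted_seqlexi_gt _ _ i k); rewrite ?mem_sorted_indices //;
  try exact: sorted_indices_ltn.
move=> j ji; have jm := ltn_trans ji (ltn_ord i).
by rewrite -[j]/(val (Ordinal jm)) !mem_sorted_indices eqIJ.
Qed.

Local Open Scope ring_scope.

(** * Sums over principal submatrices of a doubly graded matrix *)

Section GradedSums.

Variables (R : realFieldType) (m : nat) (A : 'M[R]_m).

Definition submatrix_sum (I : {set 'I_m}) : R :=
  \sum_(i in I) \sum_(j in I) A i j.

Lemma submatrix_sum_setU1 (S : {set 'I_m}) (a : 'I_m) : a \notin S ->
  submatrix_sum (a |: S) =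
  A a a + \sum_(j in S) A a j + (\sum_(i in S) A i a + submatrix_sum S).
Proof.
move=> aS; rewrite /submatrix_sum !big_setU1 //=; congr (_ + _).
by rewrite -big_split /=; apply: eq_bigr => i _; rewrite big_setU1.
Qed.

(** Row and column [a] are dominated entrywise by row and column [b]; the diagonal entries are
    compared through [A a b]. *)
Lemma le_submatrix_sum_setU1 (S : {set 'I_m}) (a b : 'I_m) :
  doubly_graded A -> (a <= b)%N -> a \notin S -> b \notin S ->
  submatrix_sum (a |: S) <= submatrix_sum (b |: S).
Proof.
move=> [rA cA] ab aS bS; rewrite !submatrix_sum_setU1 //.
have colA j : A a j <= A b j by have := cA j a b ab; rewrite !mxE.
apply: lerD; first apply: lerD.
- exact: le_trans (rA a a b ab) (colA b).
- by apply: ler_sum => j _; apply: colA.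
- by rewrite lerD2r; apply: ler_sum => j _; apply: rA.
Qed.

End GradedSums.

(** * Descent from an arbitrary spanning tree to the critical one *)

Theorem theorem10 (R : realFieldType) (V : finType) (G : sgraph V) (m : nat)
    (e : 'I_m -> {set V}) (he : edge_enumeration G e)
    (c : {set V} -> R) (q : {set V} -> {set V} -> R) (p : 'S_m)
    (hQ : doubly_graded (permute_matrix p (cost_matrix e c q)))
    (T : {set {set V}}) (hT : critical_spanning_tree G e p T) :
  qmst_optimal G c q T.
Proof.
case: hT he => treeT minT [e_inj e_im]; split=> //.
set A := permute_matrix _ _ in hQ.
(* [h k] is the edge of rank [k]; indexing by ranks turns tree costs into submatrix sums of [A]. *)
pose h k := e ((p^-1)%g k).
have h_inj : injective h by apply: inj_comp e_inj perm_inj.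
have h_onto g : g \in edges G -> exists k, g = h k.
  by rewrite -e_im => /imsetP[i _ ->]; exists (p i); rewrite /h permK.
have indE (S : {set {set V}}) k : (k \in permuted_indices e p S) = (h k \in S).
  apply/imsetP/idP=> [[i]|hkS].
    by rewrite inE => iS ->; rewrite /h permK.
  by exists ((p^-1)%g k); rewrite ?inE // permKV.
have imE (S : {set {set V}}) : S \subset edges G ->
    h @: permuted_indices e p S = S.
  move=> sS; apply/setP=> g; apply/imsetP/idP=> [[k]|gS].
    by rewrite indE => ? ->.
  have [k Eg] := h_onto g (subsetP sS _ gS).
  by exists k => //; rewrite indE -Eg.
have costE (S : {set {set V}}) : S \subset edges G ->
    qmst_cost c q S = submatrix_sum A (permuted_indices e p S).
  move=> /imE ES; rewrite /qmst_cost /submatrix_sum -big_split -{1}ES /=.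
  rewrite big_imset /=; last exact: in2W.
  apply: eq_bigr => i iS; rewrite [in RHS](bigD1 i) //= addrC; congr (_ + _).
    by rewrite !mxE eqxx.
  rewrite -{1}ES big_imset_cond /=; last exact: in2W.
  apply: eq_big => [j|j /andP[_ neq]]; first by rewrite (inj_eq h_inj).
  by rewrite !mxE (inj_eq perm_inj) eq_sym -(inj_eq h_inj) (negPf neq).
(* Induction on the number of edges of [T'] outside [T]. *)
move=> T'; have [n] := ubnP #|T' :\: T|; elim: n T' => // n IH T' leT' treeT'.
have [sT _ _] := treeT; have [sT' _ _] := treeT'.
set I := permuted_indices e p T; set I' := permuted_indices e p T'.
have [eqI|/eqP neqI] := eqVneq I I'; first by rewrite !costE // -/I eqI.
have [i0 i0P] : exists i, (i \in I) != (i \in I').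
  apply/existsP; apply: contra_notT neqI => /existsPn eqI.
  by apply/setP=> i; apply/eqP; rewrite -[_ == _]negbK eqI.
pose D := [pred i : 'I_m | (i \in I) != (i \in I')].
case: (@arg_minnP _ i0 D val i0P) => i /= iP imin.
have agree (j : 'I_m) : (j < i)%N -> (j \in I) = (j \in I').
  by move=> ji; apply/eqP; apply: contraTT ji => /imin; rewrite -leqNgt.
have larger k : (k \in I) != (k \in I') -> (k \in I) != (i \in I) -> (i < k)%N.
  move=> /imin ik neq; rewrite ltn_neqAle ik andbT.
  by apply: contraNneq neq => /val_inj->.
case: (boolP (i \in I)) iP => [iI|iI] iP.
- have iI' : i \notin I' by case: (i \in I') iP.
  have [||f [fT' fT treeT'']] := spanning_tree_exchange treeT' treeT (g := h i).
  + by rewrite -indE.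
  + by rewrite -indE.
  have [k Ef] := h_onto f (subsetP sT' _ fT').
  have kI' : k \in I' by rewrite indE -Ef.
  have kI : k \notin I by rewrite indE -Ef.
  have ik : (i < k)%N by apply: larger; rewrite ?iI (negPf kI) ?kI'.
  (* The measure drops: [f] leaves the difference, and [h i], being in [T], does not enter it. *)
  apply: le_trans (IH _ _ treeT'') _.
    rewrite -ltnS; apply: leq_trans leT'; rewrite ltnS; apply: proper_card.
    have hiT : h i \in T by rewrite -indE.
    apply/properP; split; last first.
      exists f; rewrite !inE ?fT //= eqxx orbF.
      by apply: contraNneq fT => ->.
    apply/subsetP=> g; rewrite !inE => /andP[gT]; rewrite gT.
    by case/orP=> [/eqP Eg|/andP[]//]; rewrite Eg hiT in gT.
  have [sT'' _ _] := treeT''; rewrite !costE //.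
  have -> : permuted_indices e p (h i |: T' :\ f) = i |: I' :\ k.
    by apply/setP=> j; rewrite indE !inE -/I' indE Ef !(inj_eq h_inj).
  rewrite -/I' -[in leRHS](setD1K kI'); apply: le_submatrix_sum_setU1 => //.
  + exact: ltnW.
  + by rewrite !inE (negPf iI') andbF.
  + by rewrite !inE eqxx.
- have iI' : i \in I' by case: (i \in I') iP.
  (* The exchange supplies a rank [k] of [T] beyond [i], which excludes that the ranks of [T] form a
     proper prefix of those of [T']. *)
  have [||f [fT fT' _]] := spanning_tree_exchange treeT treeT' (g := h i).
  + by rewrite -indE.
  + by rewrite -indE.
  have [k Ef] := h_onto f (subsetP sT _ fT).
  have kI : k \in I by rewrite indE -Ef.
  have kI' : k \notin I' by rewrite indE -Ef.
  have ik : (i < k)%N by apply: larger; rewrite ?(negPf iI) kI ?(negPf kI').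
  by have := sorted_indices_gt agree iI' iI kI ik; rewrite minT.
Qed.
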